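(* If $\Gamma$ is a discrete group with the Haagerup property, then the wreath product $\bigoplus_{\mathbf{Q}_2}\Gamma\rtimes V$ has the Haagerup property.
   Context: A discrete group $G$ has the Haagerup property if there is a net of positive definite functions on $G$, each vanishing at infinity (for every $\varepsilon>0$ only finitely many group elements have value of modulus $\ge\varepsilon$), converging pointwise to $1$. Thompson's group $V$: a standard dyadic interval is an interval $[\frac{a}{2^n},\frac{a+1}{2^n})$ with $n\ge 0$, $0\le a\le 2^n-1$. $V$ is the group of bijections $v$ of $[0,1)$ for which there exist two finite partitions $\{I_1,\dots,I_n\}$, $\{J_1,\dots,J_n\}$ of $[0,1)$ into standard dyadic intervals and a permutation $\pi$ such that $v$ restricts to the increasing affine bijection $I_i\to J_{\pi(i)}$ for every $i$. $\mathbf{Q}_2$ is the ($V$-invariant) set of dyadic rationals in $[0,1)$. $\bigoplus_{\mathbf{Q}_2}\Gamma$ is the group of finitely supported maps $\mathbf{Q}_2\to\Gamma$, on which $V$ acts by $(v\cdot a)(x)=a(v^{-1}x)$; the wreath product is the corresponding semidirect product. *)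

(* Defs.v *)
From HB Require Import structures.
From mathcomp Require Import all_boot all_order all_algebra.
From mathcomp Require Import all_fingroup.
From mathcomp Require Import complex finmap ring lra.
From mathcomp Require Import boolp classical_sets functions cardinality reals.

Set Implicit Arguments.
Unset Strict Implicit.
Unset Printing Implicit Defensive.

Import Order.TTheory GRing.Theory Num.Theory.

Local Open Scope classical_set_scope.
Local Open Scope ring_scope.

(* In R[i], [0 <= z] means that z is real and nonnegative. *)
Definition positive_definite (R : realType) (G : groupType) (phi : G -> R[i]) :=
  forall (n : nat) (g : 'I_n -> G) (c : 'I_n -> R[i]),
    0 <= \sum_(i < n) \sum_(j < n) (c i)^* * c j * phi ((g i)^-1 * g j)%g.

Definition vanishing_at_infinity (R : realType) (G : Type) (phi : G -> R[i]) :=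
  forall e : R, 0 < e -> finite_set [set g | e%:C%C <= `|phi g|].

Definition directed (I : Type) (le : I -> I -> Prop) :=
  [/\ inhabited I,
      forall i, le i i,
      forall i j k, le i j -> le j k -> le i k &
      forall i j, exists2 k, le i k & le j k].

Definition net_cvg (R : realType) (I : Type) (le : I -> I -> Prop)
    (z : I -> R[i]) (l : R[i]) :=
  forall e : R, 0 < e -> exists i0, forall i, le i0 i -> `|z i - l| < e%:C%C.

Definition haagerup (R : realType) (G : groupType) :=
  exists (I : Type) (le : I -> I -> Prop) (phi : I -> G -> R[i]),
    [/\ directed le,
        forall i, positive_definite (phi i),
        forall i, vanishing_at_infinity (phi i) &
        forall g, net_cvg le (fun i => phi i g) 1].

Record bijection (T : Type) := Bijection {
  bij_fun :> T -> T;
  bij_inv : T -> T;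
  bij_funK : cancel bij_fun bij_inv;
  bij_invK : cancel bij_inv bij_fun }.

Section BijectionGroup.
Variable T : Type.
Implicit Types f g h : bijection T.

Lemma bijectionP f g : bij_fun f =1 bij_fun g -> f = g.
Proof.
case: f g => [f f' fK f'K] [g g' gK g'K] /= /funext efg.
move: fK f'K gK g'K; rewrite efg => fK f'K gK g'K.
have e : f' = g' by apply/funext => x; rewrite -{1}(g'K x) fK.
move: fK f'K; rewrite e => fK f'K.
by congr Bijection; exact: Prop_irrelevance.
Qed.

HB.instance Definition _ := gen_eqMixin (bijection T).
HB.instance Definition _ := gen_choiceMixin (bijection T).

Definition bij_one := @Bijection T idfun idfun (fun=> erefl) (fun=> erefl).
Definition bij_rev f := Bijection (bij_invK f) (bij_funK f).
Definition bij_mul f g :=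
  Bijection (can_comp (bij_funK f) (bij_funK g))
            (can_comp (bij_invK g) (bij_invK f)).

Fact bij_mulA : associative bij_mul.
Proof. by move=> f g h; apply: bijectionP. Qed.
Fact bij_mul1 : left_id bij_one bij_mul.
Proof. by move=> f; apply: bijectionP. Qed.
Fact bij_mulr1 : right_id bij_one bij_mul.
Proof. by move=> f; apply: bijectionP. Qed.
Fact bij_mulV : left_inverse bij_one bij_rev bij_mul.
Proof. by move=> f; apply: bijectionP => x /=; exact: bij_funK. Qed.
Fact bij_mulrV : right_inverse bij_one bij_rev bij_mul.
Proof. by move=> f; apply: bijectionP => x /=; exact: bij_invK. Qed.

HB.instance Definition _ := isGroup.Build (bijection T)
  bij_mulA bij_mul1 bij_mulr1 bij_mulV bij_mulrV.

Lemma bij1E x : (1%g : bijection T) x = x. Proof. by []. Qed.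
Lemma bijME f g x : (f * g)%g x = f (g x). Proof. by []. Qed.
Lemma bijVE f x : (f^-1)%g x = bij_inv f x. Proof. by []. Qed.
End BijectionGroup.

Section Thompson.
Variable R : realType.

Definition unit_itv := {x : R | 0 <= x < 1}.
HB.instance Definition _ := SubChoice.on unit_itv.

(* [existT n a] stands for the interval [a / 2^n, (a + 1) / 2^n). *)
Definition sdi := {n : nat & 'I_(2 ^ n)}.

Definition sdi_set (I : sdi) : set unit_itv :=
  let: existT n a := I in
  [set x | (a : nat)%:R / 2 ^+ n <= val x < (a : nat).+1%:R / 2 ^+ n].

Definition affine_inc_bij (A B : set unit_itv) (f : unit_itv -> unit_itv) :=
  set_bij A B f /\
  exists s t : R, 0 < s /\ forall x, A x -> val (f x) = s * val x + t.

Definition sdi_partition (T : finType) (I : T -> sdi) :=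
  partition [set: T] (fun i => sdi_set (I i)) [set: unit_itv].

Definition is_thompson (v : bijection unit_itv) :=
  exists (n : nat) (I J : 'I_n -> sdi) (pi : 'S_n),
    [/\ sdi_partition I, sdi_partition J &
        forall i, affine_inc_bij (sdi_set (I i)) (sdi_set (J (pi i))) v].

Definition sdi_lo (I : sdi) : R := (tagged I : nat)%:R / 2 ^+ tag I.
Definition sdi_wd (I : sdi) : R := 1 / 2 ^+ tag I.

Lemma sdi_setE I x : sdi_set I x <-> sdi_lo I <= val x < sdi_lo I + sdi_wd I.
Proof. by case: I => n a; rewrite /sdi_lo /sdi_wd /sdi_set -mulrDl natr1. Qed.

Lemma sdi_wd_gt0 I : 0 < sdi_wd I.
Proof. by rewrite /sdi_wd divr_gt0 // exprn_gt0. Qed.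

Lemma sdi_lo_ge0 I : 0 <= sdi_lo I.
Proof. by rewrite /sdi_lo divr_ge0 // exprn_ge0. Qed.

Lemma sdi_hi_le1 I : sdi_lo I + sdi_wd I <= 1.
Proof.
case: I => n a; rewrite /sdi_lo /sdi_wd /= -mulrDl ler_pdivrMr ?exprn_gt0 //.
by rewrite mul1r natr1 -natrX ler_nat.
Qed.

Lemma sdi_point I y :
  sdi_lo I <= y < sdi_lo I + sdi_wd I -> exists2 x, sdi_set I x & val x = y.
Proof.
move=> /andP[ly yh].
have y01 : 0 <= y < 1.
  by rewrite (le_trans (sdi_lo_ge0 I) ly) (lt_le_trans yh (sdi_hi_le1 I)).
by exists (exist _ y y01) => //; apply/sdi_setE; rewrite /= ly yh.
Qed.

Lemma affine_inc_bijE I J f : affine_inc_bij (sdi_set I) (sdi_set J) f ->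
  forall x, sdi_set I x ->
    val (f x) = sdi_lo J + sdi_wd J / sdi_wd I * (val x - sdi_lo I).
Proof.
move=> [[fIJ _ fsurj] [s [t [s0 fst]]]].
have wI := sdi_wd_gt0 I; have wJ := sdi_wd_gt0 J.
have [p pI pE] : exists2 x, sdi_set I x & val x = sdi_lo I.
  by apply: sdi_point; lra.
have [q qJ qE] : exists2 x, sdi_set J x & val x = sdi_lo J.
  by apply: sdi_point; lra.
have elo : s * sdi_lo I + t = sdi_lo J.
  have /sdi_setE := fIJ _ pI; rewrite fst // pE => /andP[h _].
  have [y yI fy] := fsurj _ qJ.
  have := fst _ yI; rewrite fy qE => e.
  have /sdi_setE/andP[hy _] := yI.
  have := ler_wpM2l (ltW s0) hy; lra.
have ewd : s * sdi_wd I = sdi_wd J.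
  have [h|h|//] := ltgtP (s * sdi_wd I) (sdi_wd J).
    have [z zJ zE] : exists2 x, sdi_set J x & val x = sdi_lo J + s * sdi_wd I.
      by apply: sdi_point; have := mulr_gt0 s0 wI; lra.
    have [y yI fy] := fsurj _ zJ.
    have := fst _ yI; rewrite fy zE => e.
    have /sdi_setE/andP[_ hy] := yI.
    have : s * val y < s * (sdi_lo I + sdi_wd I) by rewrite ltr_pM2l.
    lra.
  have [x xI xE] : exists2 x, sdi_set I x & val x = sdi_lo I + sdi_wd J / s.
    apply: sdi_point.
    rewrite lerDl divr_ge0 ?ltW //= ltrD2l.
    by rewrite ltr_pdivrMr // mulrC.
  have /sdi_setE := fIJ _ xI; rewrite fst // xE mulrDr.
  rewrite [s * (_ / s)]mulrC divfK ?gt_eqF //; lra.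
move=> x xI; rewrite fst // -ewd -elo mulfK ?gt_eqF //; ring.
Qed.

Lemma affine_inc_bijI I J (f : bijection unit_itv) :
  (forall x, sdi_set I x ->
    val (f x) = sdi_lo J + sdi_wd J / sdi_wd I * (val x - sdi_lo I)) ->
  affine_inc_bij (sdi_set I) (sdi_set J) f.
Proof.
move=> fE; have wI := sdi_wd_gt0 I; have wJ := sdi_wd_gt0 J.
have s0 : 0 < sdi_wd J / sdi_wd I by rewrite divr_gt0.
have eJ : sdi_wd J / sdi_wd I * sdi_wd I = sdi_wd J by rewrite divfK ?gt_eqF.
split; [split|].
- move=> x xI; apply/sdi_setE; rewrite fE //.
  have /sdi_setE/andP[h1 h2] := xI.
  apply/andP; split; first by rewrite lerDl mulr_ge0 ?subr_ge0 // ltW.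
  by rewrite ltrD2l -[ltRHS]eJ ltr_pM2l //; lra.
- by move=> x y _ _; apply: (can_inj (bij_funK f)).
- move=> y /[dup] yJ /sdi_setE/andP[h1 h2].
  have [x xI xE] : exists2 x, sdi_set I x &
      val x = sdi_lo I + sdi_wd I / sdi_wd J * (val y - sdi_lo J).
    apply: sdi_point.
    rewrite lerDl mulr_ge0 ?subr_ge0 ?(ltW (divr_gt0 wI wJ)) //=.
    rewrite ltrD2l mulrAC ltr_pdivrMr // ltr_pM2l // ltrBlDl; exact: h2.
  exists x => //; apply: val_inj; rewrite fE // xE.
  by field; rewrite !gt_eqF.
- exists (sdi_wd J / sdi_wd I), (sdi_lo J - sdi_wd J / sdi_wd I * sdi_lo I).
  split=> // x xI.
  by rewrite fE //; ring.
Qed.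

Lemma affine_inc_bijV I J (f : bijection unit_itv) :
  affine_inc_bij (sdi_set I) (sdi_set J) f ->
  affine_inc_bij (sdi_set J) (sdi_set I) (f^-1)%g.
Proof.
move=> af; apply: affine_inc_bijI => y yJ.
have [[_ _ /(_ _ yJ)[x xI <-]] _] := af.
rewrite bijVE bij_funK (affine_inc_bijE af) //.
by field; rewrite !gt_eqF ?sdi_wd_gt0.
Qed.

Lemma affine_inc_bijM I J K (f g : bijection unit_itv) :
  affine_inc_bij (sdi_set I) (sdi_set J) f ->
  affine_inc_bij (sdi_set J) (sdi_set K) g ->
  affine_inc_bij (sdi_set I) (sdi_set K) (g * f)%g.
Proof.
move=> af ag; apply: affine_inc_bijI => x xI.
have [[/(_ _ xI) fx _ _] _] := af.
rewrite bijME (affine_inc_bijE ag) // (affine_inc_bijE af) //.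
by field; rewrite !gt_eqF ?sdi_wd_gt0.
Qed.

Definition sdi_sub I M := exists k r : nat,
  [/\ (r < 2 ^ k)%N, sdi_wd M = sdi_wd I / 2 ^+ k &
      sdi_lo M = sdi_lo I + r%:R * sdi_wd M].

Lemma sdi_subxx I : sdi_sub I I.
Proof. by exists 0%N, 0%N; split; rewrite // ?expr0 ?divr1 // mul0r addr0. Qed.

Lemma sdi_sub_ex I k r : (r < 2 ^ k)%N -> exists M,
  sdi_wd M = sdi_wd I / 2 ^+ k /\ sdi_lo M = sdi_lo I + r%:R * sdi_wd M.
Proof.
case: I => n a rk.
have h : (a * 2 ^ k + r < 2 ^ (n + k))%N.
  rewrite expnD; apply: (@leq_trans (a.+1 * 2 ^ k)); last first.
    by rewrite leq_mul2r; apply/orP; right.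
  by rewrite mulSn addnC ltn_add2r.
exists (existT (fun n => 'I_(2 ^ n)) (n + k)%N (Ordinal h)).
rewrite /sdi_wd /sdi_lo /= natrD natrM natrX exprD.
by split; field; rewrite !gt_eqF ?exprn_gt0.
Qed.

Lemma sdi_subW I M : sdi_sub I M -> sdi_set M `<=` sdi_set I.
Proof.
move=> [k [r [rk wM lM]]] x /sdi_setE/andP[h1 h2]; apply/sdi_setE.
have wM0 := sdi_wd_gt0 M.
have e : sdi_wd I = 2 ^+ k * sdi_wd M.
  by rewrite wM mulrC divfK ?gt_eqF ?exprn_gt0.
have h3 : r.+1%:R * sdi_wd M <= 2 ^+ k * sdi_wd M.
  by rewrite ler_pM2r // -natrX ler_nat.
have h4 : 0 <= r%:R * sdi_wd M by rewrite mulr_ge0 // ltW.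
move: h3; rewrite -natr1 mulrDl mul1r => h3; apply/andP; split; lra.
Qed.

Lemma sdi_nest I J :
  sdi_set I `&` sdi_set J !=set0 -> sdi_sub I J \/ sdi_sub J I.
Proof.
wlog le : I J / (tag I <= tag J)%N => [hw|] IJ.
  have [h|/ltnW h] := leqP (tag I) (tag J); first exact: hw.
  by apply/or_comm; apply: hw => //; rewrite setIC.
left; case: IJ => -[y y01] []; case: I le => n a; case: J => m b /= le.
move: le => /subnK; move: (m - n)%N => k mE; subst m.
have n0 : 0 < 2 ^+ n :> R by rewrite exprn_gt0.
have k0 : 0 < 2 ^+ k :> R by rewrite exprn_gt0.
rewrite !ler_pdivrMr ?exprn_gt0 // !ltr_pdivlMr ?exprn_gt0 //.
move=> /andP[h1 h2] /andP[]; rewrite exprD => h3 h4.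
have k1 : (a : nat)%:R * 2 ^+ k <= (y * 2 ^+ n) * 2 ^+ k.
  by rewrite ler_pM2r.
have k2 : (y * 2 ^+ n) * 2 ^+ k < (a : nat).+1%:R * 2 ^+ k.
  by rewrite ltr_pM2r.
have l1 : (a * 2 ^ k <= b)%N.
  by rewrite -ltnS -(ltr_nat R) natrM natrX; lra.
have l2 : (b < a.+1 * 2 ^ k)%N.
  by rewrite -(ltr_nat R) natrM natrX; lra.
exists k, (b - a * 2 ^ k)%N; split.
- by rewrite ltn_subLR // -mulSnr.
- by rewrite /sdi_wd /= exprD; field; rewrite !gt_eqF.
- rewrite /sdi_wd /sdi_lo /= natrB // natrM natrX exprD.
  by field; rewrite !gt_eqF.
Qed.

Lemma sdi_pullback I J M (f : bijection unit_itv) :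
  affine_inc_bij (sdi_set I) (sdi_set J) f -> sdi_sub J M ->
  exists M', affine_inc_bij (sdi_set M') (sdi_set M) f.
Proof.
move=> af [k [r [rk wM lM]]].
have [M' [wM' lM']] := sdi_sub_ex I rk.
exists M'; apply: affine_inc_bijI => x xM'.
have xI : sdi_set I x by apply: (sdi_subW _ xM'); exists k, r.
have wI := sdi_wd_gt0 I; have wJ := sdi_wd_gt0 J.
rewrite (affine_inc_bijE af) // lM lM' wM wM'; field.
by rewrite expf_neq0 // !gt_eqF.
Qed.

Lemma sdi_part_bij (T S : finType) (I : T -> sdi) (h : S -> T) :
  bijective h -> sdi_partition I -> sdi_partition (I \o h).
Proof.
move=> [h' hK h'K] [cI tI nI]; split=> //.
- rewrite -subTset => x _.
  have [i _ xi] : cover setT (fun i => sdi_set (I i)) x by rewrite cI.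
  by exists (h' i) => //=; rewrite h'K.
- by move=> i j _ _ ij; apply: (can_inj hK); exact: tI.
- by move=> i _; exact: nI.
Qed.

Lemma sdi_part_pre (T : finType) (I J : T -> sdi) (f : bijection unit_itv) :
  (forall i, affine_inc_bij (sdi_set (I i)) (sdi_set (J i)) f) ->
  sdi_partition J -> sdi_partition I.
Proof.
move=> af [cJ tJ nJ].
have pre i x : sdi_set (J i) (f x) -> sdi_set (I i) x.
  have [[_ _ su] _] := af i.
  by move=> /su[y yI /(can_inj (bij_funK f))<-].
split=> //.
- rewrite -subTset => x _.
  have [i _ xi] : cover setT (fun i => sdi_set (J i)) (f x) by rewrite cJ.
  by exists i => //; exact: pre.
- move=> i j _ _ [x [xi xj]]; apply: tJ => //; exists (f x).
  by split; [have [[h _ _] _] := af i|have [[h _ _] _] := af j]; exact: h.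
- move=> i _; have [y /= yJ] := nJ i Logic.I.
  by have [[_ _ /(_ _ yJ)[x xI _]] _] := af i; exists x.
Qed.

Lemma is_thompsonI (T : finType) (I J : T -> sdi) (v : bijection unit_itv) :
  sdi_partition I -> sdi_partition J ->
  (forall i, affine_inc_bij (sdi_set (I i)) (sdi_set (J i)) v) ->
  is_thompson v.
Proof.
move=> pI pJ av.
have bv : bijective (@enum_val T predT).
  by exists enum_rank; [exact: enum_valK|exact: enum_rankK].
exists #|T|, (I \o enum_val), (J \o enum_val), 1%g; split.
- exact: sdi_part_bij pI.
- exact: sdi_part_bij pJ.
- by move=> i; rewrite perm1; exact: av.
Qed.

Lemma is_thompsonE (v : bijection unit_itv) : is_thompson v ->
  exists n (I J : 'I_n -> sdi), [/\ sdi_partition I, sdi_partition J &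
    forall i, affine_inc_bij (sdi_set (I i)) (sdi_set (J i)) v].
Proof.
move=> [n [I [J [pi [pI pJ av]]]]]; exists n, I, (J \o pi); split=> //.
by apply: sdi_part_bij pJ; exists (pi^-1)%g; [exact: permK|exact: permKV].
Qed.

Lemma is_thompson1 : is_thompson 1%g.
Proof.
pose I : sdi := existT (fun n => 'I_(2 ^ n)) 0%N ord0.
have IT x : sdi_set I x.
  by apply/sdi_setE; rewrite /sdi_lo /sdi_wd /= expr0 !divr1 add0r; case: x.
have pI : sdi_partition (fun _ : unit => I).
  split=> //; first by rewrite -subTset => x _; exists tt.
  - by move=> [] [].
  - move=> _ _; have [|x xI _] := @sdi_point I (sdi_lo I); last by exists x.
    by have := sdi_wd_gt0 I; lra.
apply: (is_thompsonI pI pI) => _; apply: affine_inc_bijI => x _.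
by rewrite bij1E divff ?gt_eqF ?sdi_wd_gt0 //; ring.
Qed.

Lemma is_thompsonV v : is_thompson v -> is_thompson (v^-1)%g.
Proof.
move=> /is_thompsonE[n [I [J [pI pJ av]]]].
by apply: (is_thompsonI pJ pI) => i; exact: affine_inc_bijV.
Qed.

Lemma is_thompsonM v w :
  is_thompson v -> is_thompson w -> is_thompson (w * v)%g.
Proof.
move=> /is_thompsonE[n [I [J [pI pJ av]]]] /is_thompsonE[m [K [L [pK pL aw]]]].
pose T := {p : 'I_n * 'I_m |
  `[< sdi_set (J p.1) `&` sdi_set (K p.2) !=set0 >]}.
have exM (t : T) : exists M,
    [/\ sdi_sub (J (val t).1) M, sdi_sub (K (val t).2) M &
    sdi_set M = sdi_set (J (val t).1) `&` sdi_set (K (val t).2)].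
  have /asboolP/sdi_nest[h|h] := valP t.
    exists (K (val t).2); split=> //; first exact: sdi_subxx.
    by apply/esym/setIidPr; exact: sdi_subW.
  exists (J (val t).1); split=> //; first exact: sdi_subxx.
  by apply/esym/setIidPl; exact: sdi_subW.
have [M hM] := choice exM.
have exA t : exists A, affine_inc_bij (sdi_set A) (sdi_set (M t)) v.
  by have [h _ _] := hM t; exact: sdi_pullback (av _) h.
have exB t : exists B, affine_inc_bij (sdi_set B) (sdi_set (M t)) (w^-1)%g.
  by have [_ h _] := hM t; exact: sdi_pullback (affine_inc_bijV (aw _)) h.
have [A hA] := choice exA; have [B hB] := choice exB.
have pM : sdi_partition M.
  have [cJ tJ _] := pJ; have [cK tK _] := pK; split.
  - rewrite -subTset => x _.
    have [i _ xi] : cover setT (fun i => sdi_set (J i)) x by rewrite cJ.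
    have [j _ xj] : cover setT (fun i => sdi_set (K i)) x by rewrite cK.
    have ij : `[< sdi_set (J (i, j).1) `&` sdi_set (K (i, j).2) !=set0 >].
      by apply/asboolP; exists x.
    exists (exist _ (i, j) ij) => //.
    by have [_ _ ->] := hM (exist _ (i, j) ij).
  - move=> s t _ _ [x []]; have [_ _ ->] := hM s; have [_ _ ->] := hM t.
    move=> [s1 s2] [t1 t2]; apply: val_inj.
    rewrite [LHS]surjective_pairing [RHS]surjective_pairing; congr pair.
      by apply: tJ => //; exists x.
    by apply: tK => //; exists x.
  - by move=> t _; have [_ _ ->] := hM t; apply/asboolP; exact: valP t.
apply: (@is_thompsonI _ A B).
- exact: sdi_part_pre hA pM.
- exact: sdi_part_pre hB pM.
- move=> t; have := affine_inc_bijV (hB t); rewrite invgK.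
  exact: affine_inc_bijM.
Qed.

Definition thompson_pred : pred (bijection unit_itv) :=
  fun v => `[< is_thompson v >].

Fact thompson_closed : group_closed thompson_pred.
Proof.
split; first by apply/asboolP; exact: is_thompson1.
move=> v w /asboolP vV /asboolP wV; apply/asboolP.
by apply: is_thompsonM vV; exact: is_thompsonV.
Qed.

Definition thompsonV := {v : bijection unit_itv | thompson_pred v}.
HB.instance Definition _ := SubChoice.on thompsonV.
HB.instance Definition _ :=
  SubChoice_isSubGroup.Build _ _ thompsonV thompson_closed.

Definition is_dyadic (x : unit_itv) :=
  exists a n : nat, val x = a%:R / 2 ^+ n.

Definition Q2 := {x : unit_itv | `[< is_dyadic x >]}.
HB.instance Definition _ := SubChoice.on Q2.

Lemma thompson_dyadic (v : thompsonV) (x : Q2) : is_dyadic (val v (val x)).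
Proof.
have /asboolP/is_thompsonE[n [I [J [[cI _ _] _ av]]]] := valP v.
have /asboolP[c [p xE]] := valP x.
have [i _ xi] : cover setT (fun i => sdi_set (I i)) (val x) by rewrite cI.
have := affine_inc_bijE (av i) xi; move: xi => /sdi_setE; rewrite xE.
rewrite /sdi_lo /sdi_wd; case: (I i) => q a; case: (J i) => m b.
move=> /= /andP[le _] e.
have q0 : 0 < 2 ^+ q :> R by rewrite exprn_gt0.
have p0 : 0 < 2 ^+ p :> R by rewrite exprn_gt0.
have m0 : 0 < 2 ^+ m :> R by rewrite exprn_gt0.
have {}le : (a * 2 ^ p <= c * 2 ^ q)%N.
  move: le; rewrite ler_pdivrMr // mulrAC ler_pdivlMr //.
  by rewrite -!natrX -!natrM ler_nat.
exists (b * 2 ^ p + (c * 2 ^ q - a * 2 ^ p))%N, (m + p)%N.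
apply: (etrans e); rewrite natrD natrB // !natrM !natrX exprD.
by field; rewrite !gt_eqF.
Qed.

Definition Q2_act (v : thompsonV) (x : Q2) : Q2 :=
  exist _ (val v (val x)) (asboolT (thompson_dyadic v x)).

Lemma Q2_act1 x : Q2_act 1%g x = x.
Proof. exact: val_inj. Qed.

Lemma Q2_actM v w x : Q2_act (v * w)%g x = Q2_act v (Q2_act w x).
Proof. exact: val_inj. Qed.

Lemma Q2_actK v : cancel (Q2_act v) (Q2_act v^-1%g).
Proof. by move=> x; rewrite -Q2_actM mulVg Q2_act1. Qed.

Lemma Q2_actVK v : cancel (Q2_act v^-1%g) (Q2_act v).
Proof. by move=> x; rewrite -Q2_actM mulgV Q2_act1. Qed.

End Thompson.

Section Wreath.
Variables (R : realType) (Gamma : groupType).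
Local Open Scope fset_scope.

Definition dsum := {fsfun Q2 R -> Gamma with 1%g}.
Implicit Types (a b : dsum) (v w : thompsonV R).

Definition dsum_one : dsum := [fsfun].
Definition dsum_mul a b : dsum :=
  [fsfun x in finsupp a `|` finsupp b => (a x * b x)%g].
Definition dsum_inv a : dsum := [fsfun x in finsupp a => ((a x)^-1)%g].
Definition dsum_act v a : dsum :=
  [fsfun x in [fset Q2_act v y | y in finsupp a] => a (Q2_act v^-1%g x)].

Lemma dsum_oneE x : dsum_one x = 1%g.
Proof. exact: fsfun0E. Qed.

Lemma dsum_mulE a b x : dsum_mul a b x = (a x * b x)%g.
Proof.
rewrite fsfun_fun in_fsetU; case: finsuppP => xa //=.
by case: finsuppP => xb //=; rewrite mulg1.
Qed.

Lemma dsum_invE a x : dsum_inv a x = ((a x)^-1)%g.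
Proof. by rewrite fsfun_fun; case: finsuppP => //; rewrite invg1. Qed.

Lemma dsum_actE v a x : dsum_act v a x = a (Q2_act v^-1%g x).
Proof.
rewrite fsfun_fun; case: ifPn => // /imfsetP h.
case: finsuppP => // h'; exfalso; apply: h.
by exists (Q2_act v^-1%g x) => //=; rewrite Q2_actVK.
Qed.

(* An inductive type rather than a product, so as not to compete with the
   direct product group structure. *)
Record wreath := Wreath { wbase : dsum; wtop : thompsonV R }.
Implicit Types p q : wreath.

Lemma wreathP p q : wbase p =1 wbase q -> wtop p = wtop q -> p = q.
Proof. by case: p q => [a v] [b w] /= /fsfunP -> ->. Qed.

HB.instance Definition _ := gen_eqMixin wreath.
HB.instance Definition _ := gen_choiceMixin wreath.

Definition wreath_one := Wreath dsum_one 1%g.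
Definition wreath_mul p q :=
  Wreath (dsum_mul (wbase p) (dsum_act (wtop p) (wbase q)))
         (wtop p * wtop q)%g.
Definition wreath_inv p :=
  Wreath (dsum_act (wtop p)^-1%g (dsum_inv (wbase p))) (wtop p)^-1%g.

Let wE := (dsum_oneE, dsum_mulE, dsum_invE, dsum_actE).

Fact wreath_mulA : associative wreath_mul.
Proof.
move=> p q r; apply: wreathP => /= [x|]; last exact: mulgA.
by rewrite !wE invMg Q2_actM mulgA.
Qed.
Fact wreath_mul1 : left_id wreath_one wreath_mul.
Proof.
move=> p; apply: wreathP => /= [x|]; last exact: mul1g.
by rewrite !wE invg1 Q2_act1 mul1g.
Qed.
Fact wreath_mulr1 : right_id wreath_one wreath_mul.
Proof.
move=> p; apply: wreathP => /= [x|]; last exact: mulg1.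
by rewrite !wE mulg1.
Qed.
Fact wreath_mulV : left_inverse wreath_one wreath_inv wreath_mul.
Proof.
move=> p; apply: wreathP => /= [x|]; last exact: mulVg.
by rewrite !wE mulVg.
Qed.
Fact wreath_mulrV : right_inverse wreath_one wreath_inv wreath_mul.
Proof.
move=> p; apply: wreathP => /= [x|]; last exact: mulgV.
by rewrite !wE invgK Q2_actVK mulgV.
Qed.

HB.instance Definition _ := isGroup.Build wreath
  wreath_mulA wreath_mul1 wreath_mulr1 wreath_mulV wreath_mulrV.

End Wreath.

(* Main.v *)
(* The wreath product acts on the labelled embeddings [0,1) -> [0,1) whose
   labels in Gamma sit at the points of the open interval (0,1).  The set Z of
   the affine embeddings onto standard dyadic intervals with trivial labels is
   commensurated: an element (a, v) maps the embedding onto J back into Z as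
   soon as J is so small that v is affine on J and v(J) meets the support of a
   at most at its left endpoint.  Hence l^|Z \Delta gZ| is positive definite
   for 0 <= l <= 1.  A bound on |Z \Delta gZ| leaves finitely many
   possibilities for v and for the support of a, so that multiplying by
   \prod_x phi (a x), where phi is a normalized positive definite function on
   Gamma vanishing at infinity, gives a function vanishing at infinity.  It
   tends to 1 when l and phi do. *)

Require Import Defs.
From mathcomp Require Import all_boot all_order all_algebra.
From mathcomp Require Import reals.
From mathcomp Require Import all_fingroup complex finmap ring lra.
From mathcomp Require Import boolp classical_sets functions cardinality.

Set Implicit Arguments.
Unset Strict Implicit.
Unset Printing Implicit Defensive.

Import Order.TTheory GRing.Theory Num.Theory.

Local Open Scope classical_set_scope.
Local Open Scope ring_scope.

(** * Positive semidefinite kernels *)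

Section PositiveSemidefinite.
Local Open Scope sesquilinear_scope.
Variables (C : numClosedFieldType) (n : nat).
Implicit Types (K L : 'I_n -> 'I_n -> C).

Definition psd K := forall c : 'I_n -> C,
  0 <= \sum_(i < n) \sum_(j < n) (c i)^* * c j * K i j.

Lemma psd_rank1 (u : 'I_n -> C) : psd (fun i j => (u i)^* * u j).
Proof.
move=> c; rewrite (_ : \sum_i _ = (\sum_i c i * u i)^* * (\sum_i c i * u i)).
  by rewrite mulrC mul_conjC_ge0.
rewrite rmorph_sum mulr_suml; apply: eq_bigr => i _.
rewrite mulr_sumr; apply: eq_bigr => j _.
by rewrite rmorphM /= mulrACA.
Qed.

Lemma psdD K L : psd K -> psd L -> psd (fun i j => K i j + L i j).
Proof.
move=> hK hL c; have := addr_ge0 (hK c) (hL c).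
rewrite -big_split /=; under eq_bigr do rewrite -big_split /=.
by under [X in _ -> 0 <= X]eq_bigr do under eq_bigr do rewrite mulrDr.
Qed.

Lemma psdZ a K : 0 <= a -> psd K -> psd (fun i j => a * K i j).
Proof.
move=> a0 hK c; have := mulr_ge0 a0 (hK c).
rewrite mulr_sumr; under eq_bigr do rewrite mulr_sumr.
by under [X in _ -> 0 <= X]eq_bigr do under eq_bigr do rewrite mulrCA.
Qed.

Lemma psd_sum (I : finType) (K : I -> 'I_n -> 'I_n -> C) :
  (forall k, psd (K k)) -> psd (fun i j => \sum_k K k i j).
Proof.
move=> hK c; under eq_bigr do under eq_bigr do rewrite mulr_sumr.
under eq_bigr do rewrite exchange_big; rewrite exchange_big.
by apply: sumr_ge0 => k _; exact: hK.
Qed.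

(** The form is evaluated at [a] times the i-th basis vector plus [b] times the j-th. The case
    [i = j] is allowed, and gives [psd_diag]. *)
Lemma psd_pair K i j a b : psd K ->
  0 <= a^* * a * K i i + a^* * b * K i j + b^* * a * K j i + b^* * b * K j j.
Proof.
have pick (x y : C) (F : 'I_n -> C) :
    \sum_k (x * (k == i)%:R + y * (k == j)%:R) * F k = x * F i + y * F j.
  under eq_bigr do rewrite mulrDl -!mulrA; rewrite big_split -!mulr_sumr /=.
  congr (_ * _ + _ * _).
    rewrite (bigD1 i) //= eqxx mul1r big1 ?addr0 // => k /negPf->.
    by rewrite mul0r.
  rewrite (bigD1 j) //= eqxx mul1r big1 ?addr0 // => k /negPf->.
  by rewrite mul0r.
move=> /(_ (fun k => a * (k == i)%:R + b * (k == j)%:R)).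
congr (0 <= _); transitivity (\sum_k (a^* * (k == i)%:R + b^* * (k == j)%:R) *
    (\sum_l (a * (l == i)%:R + b * (l == j)%:R) * K k l)).
  apply: eq_bigr => k _; rewrite mulr_sumr; apply: eq_bigr => l _.
  by rewrite rmorphD !rmorphM !rmorph_nat mulrA.
rewrite pick !pick; ring.
Qed.

Lemma psd_diag K i : psd K -> 0 <= K i i.
Proof.
move=> /(@psd_pair _ i i 1 0).
by rewrite conjC1 conjC0 !mul1r !mul0r !addr0.
Qed.

(** Nonnegative complex numbers are real, so the test vectors (1, 1) and (1, 'i) make
    [K i j + K j i] and ['i * (K i j - K j i)] real. Comparing both with their conjugates gives the
    symmetry. *)
Lemma psd_hermitian K i j : psd K -> K j i = (K i j)^*.
Proof.
move=> hK; have di := ger0_real (psd_diag i hK).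
have dj := ger0_real (psd_diag j hK).
have realD x y z : x \is Num.real -> z \is Num.real ->
    0 <= x + y + z -> y \is @Num.real C.
  move=> xR zR /ger0_real h.
  rewrite (_ : y = x + y + z - (x + z)); last by ring.
  by rewrite rpredB // rpredD.
have /CrealP e1 : K i j + K j i \is Num.real.
  apply: (realD _ _ _ di dj).
  by have := psd_pair i j 1 1 hK; rewrite conjC1 !mul1r !addrA.
have /CrealP e2 : 'i * (K i j - K j i) \is Num.real.
  apply: (realD _ _ _ di dj).
  have := psd_pair i j 1 'i hK; rewrite conjC1 conjCi !mul1r; congr (0 <= _).
  have -> : - 'i * 'i = 1 :> C by rewrite mulNr -expr2 sqrCi opprK.
  by ring.
move: e1 e2; rewrite !rmorphM rmorphB rmorphD /= conjCi => e1.
rewrite mulNr -mulrN => /(mulfI (neq0Ci C)) e2.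
apply: (@mulIf _ 2); first by rewrite pnatr_eq0.
transitivity (K i j + K j i - (K i j - K j i)); first by ring.
by rewrite -e1 -e2; ring.
Qed.

Lemma psd_norm_le1 K i j : psd K -> K i i = 1 -> K j j = 1 -> `|K i j| <= 1.
Proof.
move=> hK di dj; have := psd_pair i j 1 (- (K i j)^*) hK.
rewrite di dj (psd_hermitian i j hK) conjC1 rmorphN /= conjCK => h.
rewrite -(@expr_le1 _ 2) // normCK -subr_ge0; apply: le_trans h _.
by rewrite le_eqVlt; apply/orP; left; apply/eqP; ring.
Qed.

(** Spectral theorem: K = P^* D P with P unitary, and the k-th vector of the decomposition is the
    k-th row of P scaled by the square root of the k-th eigenvalue. *)
Lemma psd_gram K : psd K -> exists u : 'I_n -> 'I_n -> C,
  forall i j, K i j = \sum_k (u k i)^* * u k j.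
Proof.
move=> hK; pose A := \matrix_(i, j) K i j.
have hA : A \is hermsymmx.
  apply/is_hermitianmxP; rewrite expr0 scale1r; apply/matrixP => i j.
  by rewrite !mxE; exact: psd_hermitian.
have := hermitian_normalmx hA => /orthomx_spectralP.
set P := spectralmx A; set d := spectral_diag A => AE.
have PU : P \is unitarymx := spectral_unitarymx A.
have {}AE : A = P^t* *m diag_mx d *m P by rewrite -invmx_unitary.
have KE i j : K i j = \sum_k (P k i)^* * d 0 k * P k j.
  have := congr1 (fun X : 'M_n => X i j) AE; rewrite mul_mx_diag !mxE => ->.
  by apply: eq_bigr => k _; rewrite !mxE.
have d0 k : 0 <= d 0 k.
  have /matrixP/(_ k k) : P *m A *m P^t* = diag_mx d.
    rewrite AE !mulmxA (unitarymxP PU) mul1mx.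
    by rewrite -mulmxA (unitarymxP PU) mulmx1.
  rewrite [RHS]mxE eqxx mulr1n => <-.
  (* The k-th eigenvalue is the value of the form at the conjugate of the k-th row of P. *)
  have := hK (fun i => (P k i)^*); congr (0 <= _).
  rewrite !mxE; under [RHS]eq_bigr do rewrite !mxE mulr_suml.
  rewrite exchange_big; apply: eq_bigr => j _; apply: eq_bigr => i _.
  by rewrite !mxE conjCK; ring.
exists (fun k i => sqrtC (d 0 k) * P k i) => i j; rewrite KE.
apply: eq_bigr => k _; have /ger0_real/CrealP sR : 0 <= sqrtC (d 0 k).
  by rewrite sqrtC_ge0.
by rewrite rmorphM /= sR -[in LHS](sqrtCK (d 0 k)); ring.
Qed.

(** Schur product theorem. A Gram decomposition of [K] turns the product into a sum of copies of
    [L], the k-th one rescaled by [u k]. *)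
Lemma psdM K L : psd K -> psd L -> psd (fun i j => K i j * L i j).
Proof.
move=> /psd_gram[u KE] hL.
suff h : psd (fun i j => \sum_k (u k i)^* * u k j * L i j).
  move=> c; have := h c; under eq_bigr do under eq_bigr do
    rewrite -mulr_suml -KE.
  by [].
apply: psd_sum => k c; have := hL (fun i => c i * u k i).
congr (0 <= _); apply: eq_bigr => i _; apply: eq_bigr => j _.
by rewrite rmorphM /=; ring.
Qed.

Lemma psd_prod (I : Type) (s : seq I) (K : I -> 'I_n -> 'I_n -> C) :
  (forall k, psd (K k)) -> psd (fun i j => \prod_(k <- s) K k i j).
Proof.
move=> hK; elim: s => [|k s IH] c.
  under eq_bigr do under eq_bigr do rewrite big_nil.
  by have := psd_rank1 (fun=> 1) c; rewrite conjC1 mulr1.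
under eq_bigr do under eq_bigr do rewrite big_cons.
exact: psdM.
Qed.

(** The kernel is l times the all-ones kernel plus 1 - l times the sum of the rank-one kernels of
    the two classes of [s]. *)
Lemma psd_two_valued (s : 'I_n -> bool) (l : C) : 0 <= l <= 1 ->
  psd (fun i j => if s i == s j then 1 else l).
Proof.
move=> /andP[l0 l1] c.
have := psdD (psdZ l0 (psd_rank1 (fun=> 1))) (psdZ (_ : 0 <= 1 - l)
  (psdD (psd_rank1 (fun i => (s i)%:R)) (psd_rank1 (fun i => (~~ s i)%:R)))).
rewrite subr_ge0 => /(_ l1 c); congr (0 <= _).
apply: eq_bigr => i _; apply: eq_bigr => j _; congr (_ * _).
by case: (s i); case: (s j); rewrite /= conjC1 ?conjC0; ring.
Qed.
End PositiveSemidefinite.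

(** * Commensurating actions *)

Section CommensuratingAction.
Variables (G : groupType) (X : choiceType) (act : G -> X -> X) (Z : set X).
Hypothesis act1 : forall x, act 1%g x = x.
Hypothesis actM : forall g h x, act (g * h)%g x = act g (act h x).
Hypothesis commensurated :
  forall g, finite_set [set z | Z z /\ ~ Z (act g z)].

(** Membership in gZ; thus [translate_diff g h] is the symmetric difference of gZ and hZ, and
    [zlen g] is the size of that of Z and gZ. *)
Definition in_translate g x : bool := `[< Z (act g^-1%g x) >].
Definition translate_diff g h := [set x | in_translate g x != in_translate h x].
Definition zlen g := #|` fset_set (translate_diff 1%g g)|.

Lemma actK g : cancel (act g) (act g^-1%g).
Proof. by move=> x; rewrite -actM mulVg act1. Qed.

Lemma actVK g : cancel (act g^-1%g) (act g).
Proof. by move=> x; rewrite -actM mulgV act1. Qed.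

Lemma translate_diffC g h : translate_diff g h = translate_diff h g.
Proof. by apply/seteqP; split => x; rewrite /translate_diff /= eq_sym. Qed.

Lemma finite_translate_diff g h : finite_set (translate_diff g h).
Proof.
have fin a b :
    finite_set [set x | Z (act a^-1%g x) /\ ~ Z (act b^-1%g x)].
  (* Translation by [a] carries the points of Z that b^-1 a moves out of Z onto aZ minus bZ.
     Exchanging the two elements covers the other half of the symmetric difference. *)
  apply: sub_finite_set (finite_image (act a) (commensurated (b^-1 * a)%g)).
  move=> x [xa xb]; exists (act a^-1%g x); last exact: actVK.
  by split=> //; rewrite actM actVK.
have := conj (fin g h) (fin h g); rewrite -finite_setU.
apply: sub_finite_set => x.
rewrite /translate_diff /in_translate /=.
by case: asboolP => hg; case: asboolP => hh //= _; [left|right].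
Qed.

Lemma translate_diffM k g h :
  translate_diff (k * g)%g (k * h)%g = act k @` translate_diff g h.
Proof.
apply/seteqP; split => x; rewrite /translate_diff /in_translate /=.
  rewrite !invMg !actM => d; exists (act k^-1%g x) => //; exact: actVK.
by move=> [y d <-]; rewrite !invMg !actM !actK.
Qed.

Lemma zlenE g h : #|` fset_set (translate_diff g h)| = zlen (g^-1 * h)%g.
Proof.
rewrite -[g in LHS]mulg1 -[h in LHS](mulKVg g) translate_diffM.
rewrite fset_set_image ?card_imfset //; last exact: finite_translate_diff.
exact: can_inj (actK g).
Qed.

Lemma zlenV g : zlen g^-1%g = zlen g.
Proof. by rewrite -[g^-1%g]mulg1 -zlenE translate_diffC. Qed.

(** Points of Z leaving Z under [g] lie in the symmetric difference of Z and g^-1 Z, whose size is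
    [zlen g] by [zlenV]. *)
Lemma zlen_ge g (s : seq X) : uniq s ->
  (forall z, z \in s -> Z z /\ ~ Z (act g z)) -> (size s <= zlen g)%N.
Proof.
move=> us sZ; rewrite -zlenV; apply: uniq_leq_size => // z /sZ[z1 z2].
rewrite in_fset_set ?inE; last exact: finite_translate_diff.
rewrite /translate_diff /in_translate /= invg1 act1 invgK.
by rewrite asboolT // asboolF.
Qed.

(** Each point of X contributes a factor [l] if it separates the two translates and 1 otherwise, so
    the kernel is a product of two-valued kernels. Only the finitely many points of [S] ever
    contribute [l]. *)
Lemma psd_zlen (C : numClosedFieldType) (l : C) n (g : 'I_n -> G) :
  0 <= l <= 1 -> psd (fun i j => l ^+ zlen ((g i)^-1 * g j)%g).
Proof.
move=> l01; pose D i j := fset_set (translate_diff (g i) (g j)).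
pose S := undup (flatten [seq (D p.1 p.2 : seq X) | p : 'I_n * 'I_n]).
have -> : (fun i j => l ^+ zlen ((g i)^-1 * g j)%g) = (fun i j => \prod_(x <- S)
    (if in_translate (g i) x == in_translate (g j) x then 1 else l)).
  apply/funext => i; apply/funext => j; rewrite -zlenE.
  rewrite (bigID (fun x => in_translate (g i) x == in_translate (g j) x)) /=.
  rewrite big1 ?mul1r => [|x ->//].
  rewrite (eq_bigr (fun=> l)) => [|x /negPf->//].
  rewrite big_const_seq iter_mulr_1 -size_filter; congr (_ ^+ _).
  apply: perm_size; apply: uniq_perm => [||x].
  - exact: fset_uniq.
  - by rewrite filter_uniq // undup_uniq.
  rewrite mem_filter in_fset_set; last exact: finite_translate_diff.
  have dE : (x \in translate_diff (g i) (g j)) =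
      (in_translate (g i) x != in_translate (g j) x).
    by apply/idP/idP; rewrite inE.
  rewrite -dE; have [_|xS] := boolP (x \in S); rewrite ?andbT ?andbF //.
  apply: contraNF xS => xd; rewrite /S mem_undup.
  apply/flatten_imageP; exists (i, j) => //=.
  by rewrite in_fset_set //; exact: finite_translate_diff.
by apply: psd_prod => x; exact: psd_two_valued.
Qed.
End CommensuratingAction.

(** * Reformulations of the Haagerup property *)

Section HaagerupCriteria.
Variables (R : realType) (G : groupType).
Implicit Types (phi : G -> R[i]) (F : seq G).

Lemma positive_definite_psd phi : positive_definite phi <->
  forall n (g : 'I_n -> G), psd (fun i j => phi ((g i)^-1 * g j)%g).
Proof. by []. Qed.

Lemma positive_definite_norm_le1 phi g :
  positive_definite phi -> phi 1%g = 1 -> `|phi g| <= 1.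
Proof.
move=> /positive_definite_psd pd phi1.
(* The off-diagonal entry of the kernel at the two points 1 and g is phi(g). *)
pose f (i : 'I_2) := if i == ord0 then 1%g else g.
have := @psd_norm_le1 _ _ _ ord0 ord_max (pd 2%N f).
by rewrite /f /= !mulVg invg1 mul1g; apply.
Qed.

Lemma haagerup_finite : haagerup R G ->
  forall F (e : R), 0 < e -> exists phi, [/\ positive_definite phi,
    vanishing_at_infinity phi & forall g, g \in F -> `|phi g - 1| < e%:C%C].
Proof.
move=> [I [le [phi [[[j0] _ trans ub] pd van cvg]]]] F e e0.
suff [j hj] : exists j, forall k, le j k ->
    forall g, g \in F -> `|phi k g - 1| < e%:C%C.
  by have [k jk _] := ub j j; exists (phi k); split=> // g; exact: hj.
elim: F => [|g F [j hj]]; first by exists j0.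
have [j' hj'] := cvg g _ e0; have [k jk jk'] := ub j j'.
exists k => m km h; rewrite inE => /orP[/eqP->|hF].
  by apply: hj'; exact: trans km.
by apply: hj hF; exact: trans km.
Qed.

(** The net is indexed by pairs of a finite list and a tolerance, ordered by inclusion of lists and
    decrease of tolerances. *)
Lemma finite_haagerup :
  (forall F (e : R), 0 < e -> exists phi, [/\ positive_definite phi,
    vanishing_at_infinity phi & forall g, g \in F -> `|phi g - 1| < e%:C%C]) ->
  haagerup R G.
Proof.
move=> H; pose I := (seq G * {e : R | 0 < e})%type.
have [phi hphi] := choice (fun i : I => H i.1 _ (svalP i.2)).
exists I, (fun i j => {subset i.1 <= j.1} /\ sval j.2 <= sval i.2), phi.
split; [split|by move=> i; have [] := hphi i|by move=> i; have [] := hphi i|].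
- by constructor; split; [exact: [::]|exists 1].
- by move=> i; split.
- move=> i j k [ij eij] [jk ejk].
  by split; [move=> g /ij/jk|exact: le_trans eij].
- move=> [F [e e0]] [F' [e' e'0]].
  have m0 : 0 < Num.min e e' by rewrite lt_min e0.
  exists (F ++ F', exist _ (Num.min e e') m0); split => [g|] /=;
    by rewrite ?mem_cat ?ge_min ?lexx ?orbT // => ->; rewrite ?orbT.
- move=> g e e0; exists ([:: g], exist _ e e0) => i [/= gi ei].
  have [_ _ h] := hphi i; apply: lt_le_trans (h g _) _.
    by apply: gi; rewrite inE.
  by rewrite lecR.
Qed.

Lemma haagerup_normalized : haagerup R G ->
  forall F (e : R), 0 < e -> exists phi, [/\ positive_definite phi,
    vanishing_at_infinity phi, phi 1%g = 1 &
    forall g, g \in F -> `|phi g - 1| < e%:C%C].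
Proof.
move=> /haagerup_finite H F e e0.
(* The bound 1/2 keeps r = phi(1) at least 1/2. After division by r the error is below 2d / r, hence
   below e because d is at most e / 4. *)
pose d : R := Num.min 2^-1 (e / 4).
have d0 : 0 < d by rewrite lt_min invr_gt0 divr_gt0 //= ltr0n.
have [d2 d4] : d <= 2^-1 /\ d <= e / 4 by rewrite !ge_min !lexx orbT.
have [phi [pd van near1]] := H (1%g :: F) d d0.
have p0 : 0 <= phi 1%g.
  by have := psd_diag ord0 (pd 1%N (fun=> 1%g)); rewrite mulVg.
have [r r0 phi1] : exists2 r : R, 2^-1 <= r & phi 1%g = r%:C%C.
  have := near1 1%g (mem_head _ _); move: p0.
  case: (phi 1%g) => a b; rewrite lecE => /andP[/= /eqP-> _] h.
  exists a => //; have : `|a - 1|%:C%C < d%:C%C.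
    apply: le_lt_trans h; apply: (le_trans _ (normc_ge_Re _)).
    by rewrite /= lecR.
  by rewrite ltcR ltr_norml; lra.
have r_gt0 : 0 < r by lra.
have rC_gt0 : 0 < r%:C%C :> R[i] by rewrite ltcR.
have rVE : r^-1%:C%C = (r%:C%C)^-1 :> R[i] := fmorphV _ r.
exists (fun g => r^-1%:C%C * phi g); split.
- apply/positive_definite_psd => n g; apply: psdZ; last exact: pd.
  by rewrite lecR invr_ge0 ltW.
- move=> e' e'0; have := van (r * e') (mulr_gt0 r_gt0 e'0).
  apply: sub_finite_set => g /=; rewrite rVE normrM normfV (gtr0_norm rC_gt0).
  by rewrite mulrC ler_pdivlMr // rmorphM mulrC.
- by rewrite phi1 -rmorphM /= mulVf ?gt_eqF.
- move=> g gF; have h1 := near1 1%g (mem_head _ _).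
  have h2 : `|phi g - 1| < d%:C%C by apply: near1; rewrite inE gF orbT.
  have -> : r^-1%:C%C * phi g - 1 =
      r^-1%:C%C * ((phi g - 1) - (phi 1%g - 1)) :> R[i].
    by rewrite phi1 rVE; field; rewrite gt_eqF.
  rewrite rVE normrM normfV (gtr0_norm rC_gt0) ltr_pdivrMl //.
  apply: le_lt_trans (ler_normB _ _) _; apply: lt_le_trans (ltrD h2 h1) _.
  rewrite -rmorphD -rmorphM lecR /=.
  have : 2^-1 * e <= r * e by rewrite ler_pM2r.
  lra.
Qed.
End HaagerupCriteria.

(** * Products over the support *)

Section NumProd.
Variable C : numDomainType.

Lemma norm_prod_le1 (I : eqType) (s : seq I) (z : I -> C) :
  {in s, forall i, `|z i| <= 1} -> `|\prod_(i <- s) z i| <= 1.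
Proof.
move=> h; rewrite big_seq; elim/big_rec: _ => [|i x /h zi x1].
  by rewrite normr1.
by rewrite normrM mulr_ile1.
Qed.

Lemma norm_mul_sub1 (x y : C) :
  `|x| <= 1 -> `|x * y - 1| <= `|x - 1| + `|y - 1|.
Proof.
move=> x1; have -> : x * y - 1 = (x - 1) + x * (y - 1) by ring.
apply: le_trans (ler_normD _ _) _; rewrite lerD2l normrM.
by rewrite ler_piMl.
Qed.

Lemma norm_prod_sub1 (I : eqType) (s : seq I) (z : I -> C) (d : C) :
  {in s, forall i, `|z i| <= 1} -> {in s, forall i, `|z i - 1| <= d} ->
  `|\prod_(i <- s) z i - 1| <= (size s)%:R * d.
Proof.
elim: s => [|i s IH] h1 h2; first by rewrite big_nil subrr normr0 mul0r.
rewrite big_cons /= -add1n natrD mulrDl mul1r.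
apply: le_trans (norm_mul_sub1 _ (h1 i (mem_head _ _))) _.
apply: lerD; first by apply: h2; rewrite mem_head.
by apply: IH => j js; [apply: h1|apply: h2]; rewrite inE js orbT.
Qed.
End NumProd.

Section Weight.
Variables (R : realType) (Gamma : groupType) (phi : Gamma -> R[i]).
Hypothesis phi1 : phi 1%g = 1.
Implicit Types a : dsum R Gamma.

Definition weight a := \prod_(x <- finsupp a) phi (a x).

(** As phi(1) = 1, points outside the support contribute 1; this lets several elements share one
    index list. *)
Lemma weightE a (s : seq (Q2 R)) :
  uniq s -> {subset finsupp a <= s} -> weight a = \prod_(x <- s) phi (a x).
Proof.
move=> us sub; rewrite /weight [RHS](bigID (mem (finsupp a))) /=.
rewrite [X in _ * X]big1 ?mulr1 => [|x xa]; last by rewrite fsfun_dflt.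
rewrite -[RHS]big_filter; apply: perm_big; apply: uniq_perm => [||x].
- exact: fset_uniq.
- exact: filter_uniq.
- rewrite mem_filter; case: (boolP (x \in _)) => //= xa.
  by rewrite sub.
Qed.

Lemma wreath_divE (p q : wreath R Gamma) x : wbase (p^-1 * q)%g x =
  ((wbase p (Q2_act (wtop p) x))^-1 * wbase q (Q2_act (wtop p) x))%g.
Proof. by rewrite /= dsum_mulE !dsum_actE dsum_invE invgK. Qed.

(** By [wreath_divE], the top component of [p i] only reindexes the factors. Over the union [S] of
    all supports the kernel is then a product, over points y, of kernels of [phi] at the labels at
    y. *)
Lemma weight_positive_definite : positive_definite phi ->
  positive_definite (fun p : wreath R Gamma => weight (wbase p)).
Proof.
move=> pd n p.
pose S := undup (flatten [seq (finsupp (wbase (p i)) : seq _) | i : 'I_n]).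
have inS i y : y \in finsupp (wbase (p i)) -> y \in S.
  by move=> yi; rewrite mem_undup; apply/flatten_imageP; exists i.
have wE i j : weight (wbase ((p i)^-1 * p j)%g) =
    \prod_(y <- S) phi ((wbase (p i) y)^-1 * wbase (p j) y)%g.
  rewrite (@weightE _ [seq Q2_act (wtop (p i))^-1%g y | y <- S]).
  - by rewrite big_map; apply: eq_bigr => y _; rewrite wreath_divE Q2_actVK.
  - by rewrite map_inj_uniq ?undup_uniq //; exact: can_inj (Q2_actVK _).
  - move=> x; rewrite mem_finsupp wreath_divE => h.
    apply/mapP; exists (Q2_act (wtop (p i)) x); last by rewrite Q2_actK.
    apply: contraNT h => h; rewrite !fsfun_dflt ?invg1 ?mulg1 //;
      by apply: contraNN h => /inS.
move=> c; under eq_bigr do under eq_bigr do rewrite wE.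
apply: (@psd_prod _ n _ S (fun y i j =>
  phi ((wbase (p i) y)^-1 * wbase (p j) y)%g)) => y.
exact: (pd n (fun i => wbase (p i) y)).
Qed.
End Weight.

(** * Standard dyadic intervals *)

Section DyadicIntervals.
Variable R : realType.
Implicit Types (I J K : sdi) (x y z : unit_itv R).

Fact uzero_subproof : (0 <= 0 :> R) && (0 < 1 :> R).
Proof. by rewrite lexx ltr01. Qed.

Definition uzero : unit_itv R :=
  exist (fun t => is_true (0 <= t < 1)) _ uzero_subproof.

Fact sdi_emb_subproof I y :
  0 <= sdi_lo R I + sdi_wd R I * val y < 1.
Proof.
have /andP[y0 y1] := valP y.
have := sdi_lo_ge0 R I; have := sdi_hi_le1 R I; have w0 := sdi_wd_gt0 R I.
have : sdi_wd R I * val y < sdi_wd R I * 1 by rewrite ltr_pM2l.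
have : 0 <= sdi_wd R I * val y by rewrite mulr_ge0 // ltW.
by move=> *; lra.
Qed.

Definition sdi_emb I y : unit_itv R :=
  exist (fun t => is_true (0 <= t < 1)) _ (sdi_emb_subproof I y).

Lemma sdi_embE I y :
  val (sdi_emb I y) = ((tagged I : nat)%:R + val y) / 2 ^+ tag I.
Proof. by rewrite /= /sdi_lo /sdi_wd; ring. Qed.

Lemma sdi_emb_set I y : sdi_set I (sdi_emb I y).
Proof.
apply/sdi_setE; rewrite /= lerDl ltrD2l.
have /andP[y0 y1] := valP y; have w0 := sdi_wd_gt0 R I.
by rewrite mulr_ge0 ?(ltW w0) //= gtr_pMr.
Qed.

Lemma sdi_set_emb I x : sdi_set I x -> exists y, sdi_emb I y = x.
Proof.
move=> /sdi_setE/andP[h1 h2]; have w0 := sdi_wd_gt0 R I.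
have y01 : 0 <= (val x - sdi_lo R I) / sdi_wd R I < 1.
  by rewrite divr_ge0 ?(ltW w0) ?subr_ge0 //= ltr_pdivrMr // mul1r ltrBlDl.
exists (exist (fun t => is_true (0 <= t < 1)) _ y01); apply: val_inj => /=.
by rewrite mulrC divfK ?gt_eqF //; ring.
Qed.

Lemma nat_unit_inj (a b : nat) (s t : R) :
  0 <= s < 1 -> 0 <= t < 1 -> a%:R + s = b%:R + t -> a = b /\ s = t.
Proof.
move=> /andP[s0 s1] /andP[t0 t1] e.
have ab : a = b.
  apply/eqP; rewrite eqn_leq -ltnS -[(b <= a)%N]ltnS -!(ltr_nat R) -!natr1.
  by apply/andP; split; lra.
by split=> //; move: e; rewrite ab => /addrI.
Qed.

(** At level n the index and the coordinate are the integer and fractional parts of 2^n x. *)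
Lemma sdi_emb_inj I J y z :
  tag I = tag J -> sdi_emb I y = sdi_emb J z -> I = J.
Proof.
move=> IJ e; have := congr1 val e; rewrite !sdi_embE {e}; move: IJ.
case: I J => [n a] [m b] /= nm; subst m.
have n0 : (2 ^+ n)^-1 != 0 :> R by rewrite invr_eq0 expf_neq0 ?pnatr_eq0.
move=> /(mulIf n0) e; have [ab _] := nat_unit_inj (valP y) (valP z) e.
by congr existT; exact: val_inj.
Qed.

Lemma sdi_emb_surj n x : exists I y, tag I = n /\ sdi_emb I y = x.
Proof.
have /andP[x0 x1] := valP x; have n0 : 0 < 2 ^+ n :> R by rewrite exprn_gt0.
have /andP[h1 h2] := @truncn_itv R (val x * 2 ^+ n) (mulr_ge0 x0 (ltW n0)).
have an : (Num.truncn (val x * 2 ^+ n) < 2 ^ n)%N.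
  rewrite -(ltr_nat R) natrX; apply: le_lt_trans h1 _.
  by rewrite gtr_pMl.
pose I : sdi := existT (fun n => 'I_(2 ^ n)) n (Ordinal an).
exists I; have [|y <-] := @sdi_set_emb I x; last by exists y.
by rewrite /sdi_set /= ler_pdivrMr // h1 ltr_pdivlMr.
Qed.

Fact sdi_comp_subproof I J :
  (tagged I * 2 ^ tag J + tagged J < 2 ^ (tag I + tag J))%N.
Proof.
case: I J => [n a] [m b] /=; rewrite expnD.
apply: (@leq_trans (a.+1 * 2 ^ m)); last by rewrite leq_mul2r ltn_ord orbT.
by rewrite mulSn addnC ltn_add2r.
Qed.

(** Concatenation of binary words: the part of [I] that corresponds to [J] under the affine
    embedding onto [I]. *)
Definition sdi_comp I J : sdi :=
  existT (fun n => 'I_(2 ^ n)) _ (Ordinal (sdi_comp_subproof I J)).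

Lemma sdi_comp_emb I J y : sdi_emb (sdi_comp I J) y = sdi_emb I (sdi_emb J y).
Proof.
apply: val_inj; rewrite !sdi_embE /= natrD natrM natrX exprD.
by field; rewrite !expf_neq0 ?pnatr_eq0.
Qed.

Lemma sdi_split n J : (n <= tag J)%N ->
  exists I K, tag I = n /\ J = sdi_comp I K.
Proof.
case: J => m b /= /subnKC; move: (m - n)%N => k mE; subst m.
have k0 : (0 < 2 ^ k)%N by rewrite expn_gt0.
have an : (b %/ 2 ^ k < 2 ^ n)%N by rewrite ltn_divLR // -expnD.
exists (existT (fun n => 'I_(2 ^ n)) n (Ordinal an)).
exists (existT (fun n => 'I_(2 ^ n)) k (Ordinal (ltn_pmod b k0))).
by split=> //; congr existT; apply: val_inj; exact: divn_eq.
Qed.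

(** From the level of its denominator on, a dyadic point is the left endpoint of every standard
    interval containing it. *)
Lemma dyadic_fine x : is_dyadic x ->
  exists m, forall J y, (m <= tag J)%N -> sdi_emb J y = x -> val y = 0.
Proof.
move=> [c [m xE]]; exists m => J y /subnKC mJ /(congr1 val).
rewrite xE sdi_embE; move: (tagged J : nat) => a.
rewrite -mJ exprD; move: (tag J - m)%N => k e.
have {}e : a%:R + val y = (c * 2 ^ k)%:R + 0.
  rewrite addr0 natrM natrX; apply: (@mulIf _ (2 ^+ m * 2 ^+ k)^-1).
    by rewrite invr_eq0 mulf_neq0 // expf_neq0 ?pnatr_eq0.
  by rewrite e; field; rewrite !expf_neq0 ?pnatr_eq0.
by have [] := nat_unit_inj (valP y) _ e; rewrite ?lexx ?ltr01.
Qed.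

Lemma finite_sdi_tag n : finite_set [set J : sdi | (tag J < n)%N].
Proof.
apply: (@sub_finite_set _ _ (\bigcup_(m in `I_n)
    (existT (fun n => 'I_(2 ^ n)) m @` [set: 'I_(2 ^ m)]))).
  by case=> m b /= mn; exists m => //; exists b.
by apply: bigcup_finite => // m _; apply: finite_image; exact: finite_finset.
Qed.

End DyadicIntervals.

(** * The action of the wreath product on labelled embeddings *)

Section WreathAction.
Variables (R : realType) (Gamma : groupType).
Implicit Types (a b : dsum R Gamma) (p q : wreath R Gamma) (I J K : sdi).
Implicit Types (x y : unit_itv R).

Definition label a x : Gamma := oapp a 1%g (insub x : option (Q2 R)).

Lemma label_val a (x : Q2 R) : label a (val x) = a x.
Proof. by rewrite /label valK. Qed.

Lemma label_supp a x : label a x != 1%g ->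
  exists2 z : Q2 R, z \in finsupp a & val z = x.
Proof.
rewrite /label; case: insubP => [z _ zx|] /=; last by rewrite eqxx.
by rewrite -mem_finsupp => za; exists z.
Qed.

Lemma label1 x : label (dsum_one R Gamma) x = 1%g.
Proof. by rewrite /label; case: insub => //= z; exact: dsum_oneE. Qed.

Lemma labelM a b x : label (dsum_mul a b) x = (label a x * label b x)%g.
Proof.
rewrite /label; case: insub => [z|] /=; last by rewrite mulg1.
exact: dsum_mulE.
Qed.

Lemma label_act (v : thompsonV R) a x :
  label (dsum_act v a) (val v x) = label a x.
Proof.
have [xd|xd] := pselect (is_dyadic x).
  pose z : Q2 R := exist _ x (asboolT xd).
  rewrite -[x]/(val z) -[val v _]/(val (Q2_act v z)) !label_val.
  by rewrite dsum_actE Q2_actK.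
have vxd : ~ is_dyadic (val v x).
  move=> d; apply: xd; have := thompson_dyadic v^-1%g
    (exist (fun t => is_true `[< is_dyadic t >]) _ (asboolT d)).
  by rewrite /= bij_funK.
by rewrite /label !insubN //; exact/asboolPn.
Qed.

(** Labelled embeddings are represented inside a full function space; [None] marks a point without
    label and is never changed. Labels are multiplied by the base value at the moved point. *)
Definition wact p (f : unit_itv R -> unit_itv R * option Gamma) y :=
  let x := val (wtop p) (f y).1 in
  (x, omap (fun c => (label (wbase p) x * c)%g) (f y).2).

Lemma wact1 f : wact 1%g f = f.
Proof.
apply/funext => y; rewrite /wact; case: (f y) => x [c|] //=.
by rewrite label1 mul1g.
Qed.

Lemma wactM p q f : wact (p * q)%g f = wact p (wact q f).
Proof.
apply/funext => y; rewrite /wact /=; case: (f y) => x [c|] //=.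
by rewrite labelM label_act mulgA.
Qed.

(* The left endpoint carries no label: a dyadic point is interior to only
   finitely many standard intervals, but it is the left endpoint of infinitely
   many. *)
Definition wstd I y : unit_itv R * option Gamma :=
  (sdi_emb I y, if val y == 0 then None else Some 1%g).

Lemma wact_stdP p J K : wact p (wstd J) = wstd K <->
  (forall y, val (wtop p) (sdi_emb J y) = sdi_emb K y) /\
  (forall y, val y != 0 -> label (wbase p) (sdi_emb K y) = 1%g).
Proof.
split=> [e|[ev el]].
  have ev y : val (wtop p) (sdi_emb J y) = sdi_emb K y.
    by have := congr1 (fun f => (f y).1) e.
  split=> // y y0; have := congr1 (fun f => (f y).2) e.
  by rewrite /wact /= (negPf y0) ev /= mulg1 => -[].
apply/funext => y; rewrite /wact /= ev; congr pair.
by case: ifPn => //= y0; rewrite el // mulg1.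
Qed.

Lemma wact_comp p I J K :
  wact p (wstd I) = wstd J ->
  wact p (wstd (sdi_comp I K)) = wstd (sdi_comp J K).
Proof.
move=> /wact_stdP[ev el]; apply/wact_stdP; split=> y.
  by rewrite !sdi_comp_emb ev.
move=> y0; rewrite sdi_comp_emb; apply: el; apply: contraNN y0 => /eqP.
rewrite sdi_embE; have /andP[y0 _] := valP y.
move=> /eqP; rewrite mulf_eq0 invr_eq0 expf_eq0 pnatr_eq0 andbF orbF.
by rewrite paddr_eq0 // => /andP[].
Qed.

Lemma wstd_inj : injective wstd.
Proof.
move=> I J e.
have ev y : sdi_emb I y = sdi_emb J y by have := congr1 (fun f => (f y).1) e.
(* The images of 0 and 1/2 determine the left endpoint and the width. *)
pose half := sdi_emb (existT (fun n => 'I_(2 ^ n)) 1%N ord_max) (uzero R).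
have := congr1 val (ev half).
have := congr1 val (ev (uzero R)).
rewrite /= mulr0 addr0 => e1 e2.
apply: (sdi_emb_inj _ (ev (uzero R))).
have /(congr1 (fun t => t^-1)) : sdi_wd R I = sdi_wd R J.
  by move: e1 e2; rewrite /sdi_lo /sdi_wd /=; lra.
rewrite /sdi_wd !invf_div !divr1 -!natrX => /eqP.
by rewrite eqr_nat eqn_exp2l // => /eqP.
Qed.

Lemma thompson_affine (v : thompsonV R) : exists N, forall J,
  (N <= tag J)%N -> exists K, forall y, val v (sdi_emb J y) = sdi_emb K y.
Proof.
have /asboolP/is_thompsonE[n [I [I' [[cI _ _] _ av]]]] := valP v.
(* An interval at least as deep as every cell of the source partition lies inside the cell
   containing its left endpoint, and [v] is affine there. *)
exists (\max_(i < n) tag (I i)) => J NJ.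
have [i _ /sdi_set_emb[y yE]] :
  cover setT (fun i => sdi_set (I i)) (sdi_emb J (uzero R)) by rewrite cI.
have iJ : (tag (I i) <= tag J)%N by apply: leq_trans NJ; exact: leq_bigmax.
have [J1 [J2 [tJ1 JE]]] := sdi_split iJ.
have J1E : J1 = I i.
  have e : sdi_emb J1 (sdi_emb J2 (uzero R)) = sdi_emb (I i) y.
    by rewrite yE JE sdi_comp_emb.
  exact: sdi_emb_inj tJ1 e.
exists (sdi_comp (I' i) J2) => t; rewrite JE J1E !sdi_comp_emb.
apply: val_inj; rewrite (affine_inc_bijE (av i) (sdi_emb_set _ _)) /=.
by rewrite [_ + _ - _]addrC addKr; field; rewrite gt_eqF // sdi_wd_gt0.
Qed.

Lemma wact_good p : exists N, forall J,
  (N <= tag J)%N -> exists K, wact p (wstd J) = wstd K.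
Proof.
have [N hN] := thompson_affine (wtop p).
have [m hm] := choice (fun x : Q2 R => dyadic_fine (asboolW (valP x))).
(* The depth is imposed on [J], not on its image, so support points are first pulled back by the top
   component. If such a pullback lies in [J], it is its unlabelled left endpoint. *)
exists (maxn N (\max_(x <- finsupp (wbase p)) m (Q2_act (wtop p)^-1%g x))) => J.
rewrite geq_max => /andP[/hN[K KE] mJ]; exists K; apply/wact_stdP.
split=> // y; apply: contraNeq => /label_supp[x xs xE].
apply/eqP; apply: (hm (Q2_act (wtop p)^-1%g x) J).
  by apply: leq_trans mJ; exact: leq_bigmax_seq.
by rewrite /= xE -KE /= bij_funK.
Qed.

Lemma finite_wact p :
  finite_set [set f | range wstd f /\ ~ range wstd (wact p f)].
Proof.
have [N hN] := wact_good p.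
apply: sub_finite_set (finite_image wstd (finite_sdi_tag N)).
move=> f [[J _ <-] nJ]; exists J => //=.
rewrite ltnNge; apply/negP => /hN[K KE].
by apply: nJ; exists K.
Qed.

Definition wlen p := zlen wact (range wstd) p.

Lemma wlenV p : wlen p^-1%g = wlen p.
Proof. exact: (zlenV wact1 wactM finite_wact). Qed.

(* If [p] moves [wstd J] out of [range wstd], it does so for all [N.+1]
   standard intervals containing [J]. *)
Lemma wlen_good p N J : (wlen p <= N)%N -> tag J = N ->
  exists K, wact p (wstd J) = wstd K.
Proof.
move=> pN JN; apply: contrapT => bad.
(* The level-n ancestor of [J]; beyond level N the value is a dummy, so that [choice] applies. *)
have anc n : exists I, (n <= N)%N -> tag I = n /\ exists K, J = sdi_comp I K.
  have [nN|] := leqP n N; last by exists J.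
  rewrite -JN in nN; have [I [K [tI JE]]] := sdi_split nN.
  by exists I; split=> //; exists K.
have [A hA] := choice anc.
suff : (size [seq wstd (A n) | n <- iota 0 N.+1] <= wlen p)%N.
  by rewrite size_map size_iota leqNgt ltnS pN.
apply: (zlen_ge wact1 wactM finite_wact).
  rewrite map_inj_in_uniq ?iota_uniq // => m n.
  rewrite !mem_iota !add0n !ltnS /= => /hA[mE _] /hA[nE _] /wstd_inj e.
  by rewrite -mE -nE e.
move=> f /mapP[n]; rewrite mem_iota add0n ltnS /= => /hA[_ [K JE]] ->.
split; first by exists (A n).
move=> [M _ e]; apply: bad; rewrite JE.
by exists (sdi_comp M K); exact: wact_comp.
Qed.

(** If [K] is deeper than N, its level-N ancestor [K1] is pulled back by p^-1 to a standard interval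
    [J1], since p^-1 has the same length. The suffix [K2] of [K] below [K1] is then also a suffix of
    [J], so it has length at most N. *)
Lemma wlen_good_tag p N J K : (wlen p <= N)%N -> tag J = N ->
  wact p (wstd J) = wstd K -> (tag K <= N + N)%N.
Proof.
move=> pN JN e; rewrite leqNgt; apply/negP => NK.
have [K1 [K2 [tK1 KE]]] := sdi_split (leq_trans (leq_addr N N) (ltnW NK)).
have [J1 e1] : exists J1, wact p^-1%g (wstd K1) = wstd J1.
  by apply: wlen_good tK1; rewrite wlenV.
have /wstd_inj JE : wstd (sdi_comp J1 K2) = wstd J.
  by rewrite -(wact_comp _ e1) -KE -e -wactM mulVg wact1.
have : (tag K2 <= N)%N by rewrite -JN -JE /= leq_addl.
by rewrite leqNgt; move: NK; rewrite KE /= tK1 ltn_add2l => ->.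
Qed.

End WreathAction.

(** * Finiteness of the balls of the length function *)

Lemma finite_set_coded (T : finType) (U : Type) (A : set U)
    (M : T -> U -> Prop) :
  (forall p, A p -> exists t, M t p) ->
  (forall t p q, A p -> A q -> M t p -> M t q -> p = q) -> finite_set A.
Proof.
move=> cov inj.
apply: (@sub_finite_set _ _ (\bigcup_(t in [set: T]) [set p | A p /\ M t p])).
  by move=> p Ap; have [t Mt] := cov p Ap; exists t.
apply: bigcup_finite => [|t _]; first exact: finite_finset.
have [[p [Ap Mp]]|none] := pselect (exists p, A p /\ M t p).
  by apply: sub_finite_set (finite_set1 p) => q [Aq Mq]; exact: inj Mq Mp.
by apply: sub_finite_set (finite_set0 U) => p Ap; apply: none; exists p.
Qed.

Section Proper.
Variables (R : realType) (Gamma : groupType).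
Implicit Types (p q : wreath R Gamma).

(** The images of the level-N intervals are standard of level at most 2N and determine the top
    component. The base is trivial inside these images, so it is determined by its values at their
    left endpoints. *)
Lemma finite_wlen_le N (B : set Gamma) : finite_set B ->
  finite_set
    [set p : wreath R Gamma | (wlen p <= N)%N /\ forall x, B (wbase p x)].
Proof.
move=> /finite_seqP[s BE].
pose small : finType := {m : 'I_(N + N).+1 & 'I_(2 ^ m)}.
pose sdi_of (e : small) : sdi := existT (fun n => 'I_(2 ^ n)) _ (tagged e).
pose lvl (i : 'I_(2 ^ N)) : sdi := existT (fun n => 'I_(2 ^ n)) N i.
(* [None] codes the trivial label, so that membership in [s] has to be shown only at support
   points. *)
pose code : finType := ({ffun 'I_(2 ^ N) -> small} *
  {ffun small -> option (seq_sub s)})%type.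
pose M (c : code) p :=
  (forall i, wact p (wstd Gamma (lvl i)) = wstd Gamma (sdi_of (c.1 i))) /\
  (forall e, Some (label (wbase p) (sdi_emb (sdi_of e) (uzero R))) =
     omap (fun t => ssval t) (c.2 e) \/
     label (wbase p) (sdi_emb (sdi_of e) (uzero R)) = 1%g /\ c.2 e = None).
apply: (@finite_set_coded code _ _ M).
- move=> p [pN pB].
  have ex1 i : exists e : small,
      wact p (wstd Gamma (lvl i)) = wstd Gamma (sdi_of e).
    have [[n a] KE] := wlen_good pN (erefl : tag (lvl i) = N).
    have nN := wlen_good_tag pN (erefl : tag (lvl i) = N) KE.
    by exists (existT (fun m : 'I_(N + N).+1 => 'I_(2 ^ m))
      (Ordinal (nN : (n < (N + N).+1)%N)) a).
  have ex2 (e : small) : exists t : option (seq_sub s),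
      Some (label (wbase p) (sdi_emb (sdi_of e) (uzero R))) =
        omap (fun t => ssval t) t \/
      label (wbase p) (sdi_emb (sdi_of e) (uzero R)) = 1%g /\ t = None.
    set x := sdi_emb _ _.
    have [l1|l1] := eqVneq (label (wbase p) x) 1%g; first by exists None; right.
    have [z _ zx] := label_supp l1; have zs : label (wbase p) x \in s.
      by have := pB z; rewrite BE /= -label_val zx.
    by exists (Some (SeqSub zs)); left.
  have [f hf] := choice ex1; have [h hh] := choice ex2.
  by exists ([ffun i => f i], [ffun e => h e]); split=> i; rewrite ffunE.
- move=> [f h] p q _ _ [/= pf ph] [/= qf qh].
  have vE x : val (wtop p) x = val (wtop q) x.
    have [[n a] [y [/= nN <-]]] := sdi_emb_surj N x; subst n.
    have /wact_stdP[pv _] := pf a; have /wact_stdP[qv _] := qf a.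
    by rewrite -/(lvl a) pv qv.
  apply: wreathP; last by apply: val_inj; exact: bijectionP.
  move=> z; rewrite -!label_val; set x := val z.
  have [[n a] [y [/= nN yE]]] := sdi_emb_surj N (val (wtop p)^-1%g x).
  subst n; have /wact_stdP[pv pl] := pf a; have /wact_stdP[qv ql] := qf a.
  have xE : sdi_emb (sdi_of (f a)) y = x.
    by rewrite -pv /lvl yE /= bij_invK.
  (* Inside the image interval both labels are trivial; at its left endpoint the label is read off
     from the code. *)
  have [y0|y0] := eqVneq (val y) 0; last by rewrite -xE pl // ql.
  have yz : y = uzero R by exact: val_inj.
  move: (ph (f a)) (qh (f a)); rewrite -yz xE.
  case: (h (f a)) => [t|] /= [e1|[e1 _]] // [e2|[e2 _]] //.
    by move: e1 e2 => [->] [->].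
  by rewrite e1.
Qed.

End Proper.

(** * The approximating functions on the wreath product *)

Section Length.
Variable R : realType.

Lemma bernoulli_le (d : R) n : 0 <= d -> 1 + n%:R * d <= (1 + d) ^+ n.
Proof.
move=> d0; elim: n => [|n IH]; first by rewrite mul0r addr0 expr0.
rewrite exprS; have : (1 + d) * (1 + n%:R * d) <= (1 + d) * (1 + d) ^+ n.
  by rewrite ler_wpM2l // addr_ge0.
apply: le_trans; rewrite -natr1.
have : 0 <= n%:R * d * d by rewrite !mulr_ge0.
by move=> *; lra.
Qed.

Lemma inv_exp_small (d e : R) : 0 < d -> 0 < e ->
  (* By Bernoulli it suffices that n d exceeds 1 / e. *)
  exists N, forall n, (N <= n)%N -> (1 + d)^-1 ^+ n < e.
Proof.
move=> d0 e0; pose t := e^-1 / d.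
have t0 : 0 <= t by rewrite divr_ge0 ?invr_ge0 ?(ltW e0) ?(ltW d0).
exists (Num.truncn t).+1 => n Nn; have /andP[_ tN] := truncn_itv t0.
have d1 : 0 < 1 + d := addr_gt0 ltr01 d0.
rewrite exprVn invf_plt ?posrE ?exprn_gt0 //.
apply: lt_le_trans (bernoulli_le n (ltW d0)).
have : e^-1 < n%:R * d.
  by rewrite -ltr_pdivrMr //; apply: lt_le_trans tN _; rewrite ler_nat.
lra.
Qed.
End Length.

Section WreathFunction.
Variables (R : realType) (Gamma : groupType) (phi : Gamma -> R[i]) (d : R).
Hypotheses (d0 : 0 < d) (phi1 : phi 1%g = 1) (pd : positive_definite phi).
Implicit Types (p : wreath R Gamma).

(** With this choice the powers of [l] tend to 0 for each d > 0, while 1 - l is at most d, the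
    tolerance also imposed on [phi]. *)
Let l : R[i] := (1 + d)^-1%:C%C.

Definition wreath_fun p : R[i] := l ^+ wlen p * weight phi (wbase p).

Let l01 : 0 <= l <= 1.
Proof.
have d1 : 0 < 1 + d := addr_gt0 ltr01 d0.
by rewrite !lecR invr_ge0 invf_le1 // (ltW d1) lerDl ltW.
Qed.

Let phi_le1 g : `|phi g| <= 1.
Proof. exact: positive_definite_norm_le1. Qed.

Lemma wreath_fun_positive_definite : positive_definite wreath_fun.
Proof.
move=> n g; apply: psdM; last exact: weight_positive_definite.
exact: (psd_zlen (@wact1 R Gamma) (@wactM R Gamma) (@finite_wact R Gamma)).
Qed.

Lemma norm_weight_le p x :
  `|weight phi (wbase p)| <= `|phi (wbase p x)|.
Proof.
case: (finsuppP (wbase p) x) => xp.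
  by rewrite phi1 normr1; apply: norm_prod_le1 => y _; exact: phi_le1.
rewrite /weight (big_rem x) //= normrM ler_piMr //.
by apply: norm_prod_le1 => y _; exact: phi_le1.
Qed.

(** Both factors have modulus at most 1, so a value of modulus at least e bounds the length and
    forces |phi| to be at least e at every label. [finite_wlen_le] then applies. *)
Lemma wreath_fun_vanishing :
  vanishing_at_infinity phi -> vanishing_at_infinity wreath_fun.
Proof.
move=> van e e0; have [N hN] := inv_exp_small d0 e0.
have fB : finite_set (1%g |` [set g | e%:C%C <= `|phi g|]).
  by rewrite finite_setU; split; [exact: finite_set1|exact: van].
apply: sub_finite_set (@finite_wlen_le R Gamma N _ fB) => p /=.
have /andP[l0 l1] := l01.
rewrite normrM normrX (ger0_norm l0) => ep; split.
  rewrite leqNgt; apply/negP => /ltnW/hN; rewrite -ltcR rmorphXn /= => h.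
  have w1 : `|weight phi (wbase p)| <= 1.
    by apply: norm_prod_le1 => y _; exact: phi_le1.
  suff : l ^+ wlen p < l ^+ wlen p by rewrite ltxx.
  apply: lt_le_trans h (le_trans ep _).
  by rewrite ler_piMr // exprn_ge0.
move=> x; right; apply: le_trans ep _; apply: le_trans (norm_weight_le p x).
by rewrite ler_piMl // exprn_ile1.
Qed.

Lemma wreath_fun_near1 p :
  (forall x, x \in finsupp (wbase p) -> `|phi (wbase p x) - 1| <= d%:C%C) ->
  `|wreath_fun p - 1| <= ((wlen p + #|` finsupp (wbase p)|)%:R * d)%:C%C.
Proof.
move=> near1; have /andP[l0 l1] := l01.
have ln1 : `|l ^+ wlen p| <= 1 by rewrite normrX exprn_ile1 // ger0_norm.
apply: le_trans (norm_mul_sub1 _ ln1) _.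
rewrite natrD mulrDl rmorphD /= !rmorphM !rmorph_nat; apply: lerD.
  (* Written as a product, the power has [wlen p] factors, each within d of 1. *)
  have -> : l ^+ wlen p = \prod_(x <- nseq (wlen p) tt) l.
    by rewrite big_const_seq count_predT size_nseq iter_mulr_1.
  rewrite -[X in X%:R](size_nseq (wlen p) tt); apply: norm_prod_sub1 => _ _.
    by rewrite ger0_norm.
  rewrite distrC ger0_norm ?subr_ge0 // -[1]/(1%:C%C) -rmorphB lecR /=.
  have d1 : 0 < 1 + d := addr_gt0 ltr01 d0.
  have -> : 1 - (1 + d)^-1 = d / (1 + d) by field; rewrite gt_eqF.
  by rewrite ler_pdivrMr // ler_peMr ?(ltW d0) // lerDl ltW.
by apply: norm_prod_sub1 => x xp; [exact: phi_le1|exact: near1].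
Qed.
End WreathFunction.

Theorem theorem5p5 (R : realType) (Gamma : groupType) :
  haagerup R Gamma -> haagerup R (wreath R Gamma).
Proof.
move=> /haagerup_normalized H; apply: finite_haagerup => F e e0.
(* The number of factors of [wreath_fun] is at most m on [F]. A tolerance e / (m + 1) per factor
   keeps the total error strictly below e, also when m = 0. *)
pose m := \max_(p <- F) (wlen p + #|` finsupp (wbase p)|)%N.
have d0 : 0 < e / m.+1%:R by rewrite divr_gt0.
have [phi [pd van phi1 near1]] :=
  H (flatten [seq [seq wbase p x | x <- finsupp (wbase p)] | p <- F]) _ d0.
exists (wreath_fun phi (e / m.+1%:R)); split.
- exact: wreath_fun_positive_definite.
- exact: wreath_fun_vanishing.
- move=> p pF; apply: le_lt_trans (wreath_fun_near1 d0 phi1 pd _) _.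
    move=> x xp; apply/ltW/near1/flatten_mapP; exists p => //.
    by apply/mapP; exists x.
  rewrite ltcR mulrA ltr_pdivrMr // mulrC ltr_pM2l // ltr_nat ltnS.
  exact: leq_bigmax_seq.
Qed.
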